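(* Let $n \ge 1$ be an integer. Let $G$ be a finite group acting (by ring automorphisms) on a Noetherian commutative ring $B$. Assume that the order $|G|$ of $G$ belongs to $B^\times$, the unit group of $B$. If $B$ satisfies Serre's $(S_n)$ condition, then so does the ring of invariants $B^G$.
   Context: All rings are commutative with identity. $B^G = \{ b \in B : gb = b \text{ for all } g \in G \}$ is the subring of invariants. A Noetherian commutative ring $R$ satisfies Serre's condition $(S_n)$ if $\operatorname{depth} R_{\mathfrak{p}} \ge \min(n, \dim R_{\mathfrak{p}})$ for every $\mathfrak{p} \in \operatorname{Spec} R$; saying that a ring satisfies $(S_n)$ includes that it is Noetherian. *)

(* Defs.v *)
From HB Require Import structures.
From mathcomp Require Import all_boot all_order all_algebra all_fingroup.
From mathcomp Require Import boolp classical_sets constructive_ereal.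
From mathcomp Require Import ring.

Set Implicit Arguments.
Unset Strict Implicit.
Unset Printing Implicit Defensive.

Import Order.TTheory GRing.Theory Num.Theory.
Local Open Scope classical_set_scope.
Local Open Scope quotient_scope.
Local Open Scope ring_scope.

(* Rings are comPzRingType, so that the zero ring is allowed; this excludes   *)
(* GRing.unit and the (proper) ideals of ring_quotient, which assume 1 != 0.  *)

Definition is_unit (R : comPzRingType) (x : R) : Prop := exists y, x * y = 1.

Definition is_ideal (R : comPzRingType) (I : set R) : Prop :=
  [/\ I 0, forall x y, I x -> I y -> I (x + y) & forall a x, I x -> I (a * x)].

Definition is_prime (R : comPzRingType) (P : set R) : Prop :=
  [/\ is_ideal P, ~ P 1 & forall x y, P (x * y) -> P x \/ P y].

Record spec (R : comPzRingType) :=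
  Spec { spec_set :> R -> Prop; specP : is_prime spec_set }.

Definition ideal_gen (R : comPzRingType) (s : seq R) : set R :=
  [set y | exists c : 'I_(size s) -> R, y = \sum_(i < size s) c i * s`_i].

Definition noetherian (R : comPzRingType) : Prop :=
  forall I : set R, is_ideal I -> exists s : seq R, I = ideal_gen s.

(* The localization of R at a prime P: the quotient of the pairs (a, s),      *)
(* s outside P, by (a, s) ~ (b, t) iff u (a t - b s) = 0 for some u outside P *)
Section Localization.
Variables (R : comPzRingType) (P : spec R).

Definition frac := {x : R * R | ~~ `[< P x.2 >]}.

Lemma fracP (x : frac) : ~ P (val x).2.
Proof. exact/asboolPn/(valP x). Qed.
Arguments fracP : clear implicits.

Lemma spec_notM s t : ~ P s -> ~ P t -> ~ P (s * t).
Proof. by case: (specP P) => _ _ h Ps Pt /h[]. Qed.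

Definition mkfrac (a s : R) (Ps : ~ P s) : frac :=
  exist _ (a, s) (introT (asboolPn _) Ps).

Definition frac_equiv (x y : frac) : bool :=
  `[< exists2 u, ~ P u &
      u * ((val x).1 * (val y).2 - (val y).1 * (val x).2) = 0 >].

Lemma frac_equiv_refl : reflexive frac_equiv.
Proof.
by move=> x; apply/asboolP; exists 1; [case: (specP P)|rewrite subrr mulr0].
Qed.

Lemma frac_equiv_sym : symmetric frac_equiv.
Proof.
suff h x y : frac_equiv x y -> frac_equiv y x by move=> x y; apply/idP/idP => /h.
move=> /asboolP[u Pu e]; apply/asboolP; exists u => //.
by rewrite -opprB mulrN e oppr0.
Qed.

Lemma frac_equiv_trans : transitive frac_equiv.
Proof.
move=> y x z /asboolP[u Pu e] /asboolP[v Pv f]; apply/asboolP.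
exists (u * v * (val y).2).
  by apply: spec_notM; [apply: spec_notM|apply: fracP].
move: (val x) (val y) (val z) e f => [a s] [b t] [c r] /= e f.
have -> : u * v * t * (a * r - c * s) =
  v * r * (u * (a * t - b * s)) + u * s * (v * (b * r - c * t)) by ring.
by rewrite e f !mulr0 addr0.
Qed.

Canonical frac_equiv_rel :=
  EquivRel frac_equiv frac_equiv_refl frac_equiv_sym frac_equiv_trans.

Definition loc := {eq_quot frac_equiv}.

HB.instance Definition _ : EqQuotient _ frac_equiv loc := EqQuotient.on loc.
HB.instance Definition _ := Choice.on loc.

Definition addf (x y : frac) : frac :=
  mkfrac ((val x).1 * (val y).2 + (val y).1 * (val x).2)
         (spec_notM (fracP x) (fracP y)).

Definition mulf (x y : frac) : frac :=
  mkfrac ((val x).1 * (val y).1) (spec_notM (fracP x) (fracP y)).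

Definition oppf (x : frac) : frac := mkfrac (- (val x).1) (fracP x).

Definition constf (a : R) : frac :=
  mkfrac a (let: And3 _ P1 _ := specP P in P1).

Lemma pi_locP (x y : frac) :
  (exists2 u, ~ P u &
     u * ((val x).1 * (val y).2 - (val y).1 * (val x).2) = 0) <->
  \pi_loc x = \pi_loc y.
Proof.
by split=> [e|/eqmodP/asboolP//]; apply/eqmodP/asboolP.
Qed.

Definition add_loc := lift_op2 loc addf.
Definition mul_loc := lift_op2 loc mulf.
Definition opp_loc := lift_op1 loc oppf.

Definition loc_inj (a : R) : loc := \pi_loc (constf a).

Lemma pi_add_loc : {morph \pi_loc : x y / addf x y >-> add_loc x y}.
Proof.
move=> x y; unlock add_loc; apply/pi_locP.
have /esym/pi_locP[u Pu] := reprK (\pi_loc x).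
have /esym/pi_locP[v Pv] := reprK (\pi_loc y).
move=> f e; exists (u * v); first exact: spec_notM.
move: e f => /=; move: (sval x) (sval y) (sval (generic_quotient.repr (\pi_loc x))) (sval (generic_quotient.repr (\pi_loc y))).
move=> [a s] [b t] [a' s'] [b' t'] /= e f.
have -> : u * v * ((a * t + b * s) * (s' * t') - (a' * t' + b' * s') * (s * t))
  = v * t * t' * (u * (a * s' - a' * s)) + u * s * s' * (v * (b * t' - b' * t)).
  by ring.
by rewrite e f !mulr0 addr0.
Qed.
Canonical pi_add_loc_morph := PiMorph2 pi_add_loc.

Lemma pi_mul_loc : {morph \pi_loc : x y / mulf x y >-> mul_loc x y}.
Proof.
move=> x y; unlock mul_loc; apply/pi_locP.
have /esym/pi_locP[u Pu] := reprK (\pi_loc x).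
have /esym/pi_locP[v Pv] := reprK (\pi_loc y).
move=> f e; exists (u * v); first exact: spec_notM.
move: e f => /=; move: (sval x) (sval y) (sval (generic_quotient.repr (\pi_loc x))) (sval (generic_quotient.repr (\pi_loc y))).
move=> [a s] [b t] [a' s'] [b' t'] /= e f.
have -> : u * v * (a * b * (s' * t') - a' * b' * (s * t))
  = v * b * t' * (u * (a * s' - a' * s)) + u * a' * s * (v * (b * t' - b' * t)).
  by ring.
by rewrite e f !mulr0 addr0.
Qed.
Canonical pi_mul_loc_morph := PiMorph2 pi_mul_loc.

Lemma pi_opp_loc : {morph \pi_loc : x / oppf x >-> opp_loc x}.
Proof.
move=> x; unlock opp_loc; apply/pi_locP.
have /esym/pi_locP[u Pu e] := reprK (\pi_loc x); exists u => //.
by move: e => /= e; rewrite !mulNr -opprD mulrN e oppr0.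
Qed.
Canonical pi_opp_loc_morph := PiMorph1 pi_opp_loc.

Lemma frac_eq (x y : frac) :
  (val x).1 * (val y).2 = (val y).1 * (val x).2 -> \pi_loc x = \pi_loc y.
Proof.
move=> e; apply/pi_locP; exists 1; last by rewrite e subrr mulr0.
by case: (specP P).
Qed.

Lemma add_locA : associative add_loc.
Proof.
elim/quotW=> x; elim/quotW=> y; elim/quotW=> z.
by rewrite !piE; apply: frac_eq => /=; ring.
Qed.

Lemma add_locC : commutative add_loc.
Proof.
by elim/quotW=> x; elim/quotW=> y; rewrite !piE; apply: frac_eq => /=; ring.
Qed.

Lemma add_0loc : left_id (loc_inj 0) add_loc.
Proof.
by elim/quotW=> x; rewrite /loc_inj !piE; apply: frac_eq => /=; ring.
Qed.

Lemma add_Nloc : left_inverse (loc_inj 0) opp_loc add_loc.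
Proof.
by elim/quotW=> x; rewrite /loc_inj !piE; apply: frac_eq => /=; ring.
Qed.

Lemma mul_locA : associative mul_loc.
Proof.
elim/quotW=> x; elim/quotW=> y; elim/quotW=> z.
by rewrite !piE; apply: frac_eq => /=; ring.
Qed.

Lemma mul_locC : commutative mul_loc.
Proof.
by elim/quotW=> x; elim/quotW=> y; rewrite !piE; apply: frac_eq => /=; ring.
Qed.

Lemma mul_1loc : left_id (loc_inj 1) mul_loc.
Proof.
by elim/quotW=> x; rewrite /loc_inj !piE; apply: frac_eq => /=; ring.
Qed.

Lemma mul_locDl : left_distributive mul_loc add_loc.
Proof.
elim/quotW=> x; elim/quotW=> y; elim/quotW=> z.
by rewrite !piE; apply: frac_eq => /=; ring.
Qed.

HB.instance Definition _ :=
  GRing.isZmodule.Build loc add_locA add_locC add_0loc add_Nloc.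
HB.instance Definition _ :=
  GRing.Zmodule_isComPzRing.Build loc mul_locA mul_locC mul_1loc mul_locDl.

End Localization.

(* The supremum in [-oo, +oo] of a set of natural numbers.                    *)
Definition sup_nat (A : set nat) : \bar int :=
  supremum -oo%E [set (k%:Z)%:E | k in A].

Definition prime_chain (R : comPzRingType) (k : nat) (c : 'I_k.+1 -> spec R) :=
  forall i j : 'I_k.+1, (i < j)%N -> spec_set (c i) `<` spec_set (c j).

Definition krull_dim (R : comPzRingType) : \bar int :=
  sup_nat [set k | exists c : 'I_k.+1 -> spec R, prime_chain c].

(* s`_i is a nonzerodivisor on R / (s_0, ..., s_(i-1)) for all i, and         *)
(* R / (s) is nonzero.                                                        *)
Definition regular_seq (R : comPzRingType) (s : seq R) : Prop :=
  (forall i, (i < size s)%N -> forall y,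
     ideal_gen (take i s) (s`_i * y) -> ideal_gen (take i s) y)
  /\ ~ ideal_gen s 1.

(* The depth of a local ring R, whose maximal ideal is the set of nonunits.   *)
Definition depth (R : comPzRingType) : \bar int :=
  sup_nat [set k | exists s : seq R,
    [/\ size s = k, forall x, x \in s -> ~ is_unit x & regular_seq s]].

Definition serre (n : nat) (R : comPzRingType) : Prop :=
  noetherian R /\
  forall P : spec R, (mine (n%:Z)%:E (krull_dim (loc P)) <= depth (loc P))%E.

Record ring_action (G : finGroupType) (B : comPzRingType) := RingAction {
  ract :> G -> {rmorphism B -> B};
  ract1 : forall b, ract 1%g b = b;
  ractM : forall g h b, ract (g * h)%g b = ract g (ract h b) }.

Section Invariants.
Variables (G : finGroupType) (B : comPzRingType) (act : ring_action G B).

Definition invariant : {pred B} := [pred b | [forall g : G, act g b == b]].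

Lemma invariantP b : reflect (forall g, act g b = b) (b \in invariant).
Proof. exact: 'forall_eqP. Qed.

Lemma invariant_subring_closed : subring_closed invariant.
Proof.
split=> [|x y /invariantP hx /invariantP hy|x y /invariantP hx /invariantP hy];
  apply/invariantP => g; first exact: rmorph1.
- by rewrite rmorphB hx hy.
- by rewrite rmorphM hx hy.
Qed.

HB.instance Definition _ :=
  GRing.isSubringClosed.Build B invariant invariant_subring_closed.

Record invariants := Invariants
  { invariants_val : B; _ : invariants_val \in invariant }.

HB.instance Definition _ := [isSub for invariants_val].
HB.instance Definition _ := [Choice of invariants by <:].
HB.instance Definition _ :=
  GRing.SubChoice_isSubComPzRing.Build B _ invariants invariant_subring_closed.

End Invariants.

(* Main.v *)
Require Import Defs.
From mathcomp Require Import all_boot all_order all_algebra all_fingroup.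
From mathcomp Require Import boolp classical_sets constructive_ereal.
From mathcomp Require Import ring.

(** The averaging operator [rho b = |G|^-1 \sum_g g b] is a retraction of [B] onto
    [A = B^G] that is linear over [A]. It makes [A] Noetherian, it puts a prime of
    [B] over every prime of [A], and it shows that elements of [A] that form a
    regular sequence on [B] form one on [A]. With norms it also gives going down
    from [B] to [A]: see [retract_noetherian], [retract_lying_over],
    [retract_regular] and [invariants_going_down].

    Given a prime [p] of [A], choose elements of [p] one after the other, so that
    they form a regular sequence on [B_p], hence on [A_p]. Either this goes on until
    there are [n] of them, and then [depth A_p >= n]; or, after [k] steps, all
    elements of [p] are zero divisors on the quotient of [B_p] by the sequence. Then,
    by prime avoidance, [p] kills a nonzero element of this quotient whose
    annihilator is a prime [Q] of [B], which lies over [p]. The sequence is therefore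
    a maximal regular sequence of [B_Q], so that [depth B_Q <= k]. Going down gives
    [dim A_p <= dim B_Q], and the condition on [B] concludes:
    [min (n, dim A_p) <= min (n, dim B_Q) <= depth B_Q <= k <= depth A_p].
    This is [retract_serre].

    The step [depth B_Q <= k] says that no regular sequence in [Q B_Q] is longer
    than a maximal one. It is proved without homological algebra by the exchange
    argument of [socle_exchange].

    Three kinds of fractions occur, with denominators in [B] outside [Q], in [A]
    outside [p], and in the image of the latter in [B]. To treat them alike, and to
    compare them, one replaces the ideals of a ring of fractions [S^-1 R] by the
    [S]-saturated ideals of [R]. The sections on localization translate depth and
    dimension of the local rings into this language. *)

Set Implicit Arguments.
Unset Strict Implicit.
Unset Printing Implicit Defensive.

Import Order.TTheory GRing.Theory Num.Theory.
Local Open Scope classical_set_scope.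
Local Open Scope quotient_scope.
Local Open Scope ring_scope.

(** * Ideals of a Noetherian ring *)

Section Ideals.
Variable R : comPzRingType.
Implicit Types (I J K P : set R) (s : seq R).

Lemma ideal0 I : is_ideal I -> I 0. Proof. by case. Qed.

Lemma idealD I x y : is_ideal I -> I x -> I y -> I (x + y).
Proof. by case=> _ + _; apply. Qed.

Lemma ideal_mull I a x : is_ideal I -> I x -> I (a * x).
Proof. by case=> _ _; apply. Qed.

Lemma ideal_mulr I a x : is_ideal I -> I x -> I (x * a).
Proof. by rewrite mulrC; apply: ideal_mull. Qed.

Lemma idealN I x : is_ideal I -> I x -> I (- x).
Proof. by rewrite -mulN1r; apply: ideal_mull. Qed.

Lemma idealB I x y : is_ideal I -> I x -> I y -> I (x - y).
Proof. by move=> hI hx hy; apply: idealD => //; apply: idealN. Qed.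

Lemma ideal_sum I (T : Type) (r : seq T) (p : pred T) (F : T -> R) :
  is_ideal I -> (forall i, p i -> I (F i)) -> I (\sum_(i <- r | p i) F i).
Proof.
move=> hI hF; apply: (big_ind I) => //; first exact: ideal0.
by move=> x y; apply: idealD.
Qed.

Lemma ideal_genP s : is_ideal (ideal_gen s).
Proof.
split=> [|_ _ [c ->] [d ->]|a _ [c ->]].
- by exists (fun=> 0); rewrite big1 // => i _; rewrite mul0r.
- exists (fun i => c i + d i); rewrite -big_split.
  by apply: eq_bigr => i _; rewrite mulrDl.
- exists (fun i => a * c i); rewrite mulr_sumr.
  by apply: eq_bigr => i _; rewrite mulrA.
Qed.

Lemma mem_ideal_gen s x : x \in s -> ideal_gen s x.
Proof.
move=> xs; have lt_xs : (index x s < size s)%N by rewrite index_mem.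
exists (fun i => if i == Ordinal lt_xs then 1 else 0).
rewrite (bigD1 (Ordinal lt_xs)) //= eqxx mul1r nth_index // big1 ?addr0 //.
by move=> i /negPf->; rewrite mul0r.
Qed.

Lemma ideal_gen_sub s I :
  is_ideal I -> (forall x, x \in s -> I x) -> ideal_gen s `<=` I.
Proof.
move=> hI sI _ [c ->]; apply: ideal_sum => // i _.
by apply: ideal_mull => //; apply/sI/mem_nth.
Qed.

(** The ascending chain condition in the form that is used: were there no
    maximal member, dependent choice would give a strictly increasing chain,
    and the finitely many generators of its union would all lie in one term. *)
Lemma noetherian_max (F : set (set R)) I0 : noetherian R ->
  (forall I, F I -> is_ideal I) -> F I0 ->
  exists2 M, F M & forall I, F I -> M `<=` I -> I `<=` M.
Proof.
move=> nR Fideal FI0; apply: contrapT => noM.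
have step (I : {I | F I}) :
    exists I' : {I | F I}, sval I `<=` sval I' /\ ~ sval I' `<=` sval I.
  apply: contrapT => nI; apply: noM; exists (sval I); first exact: svalP I.
  move=> I' FI' sII'; apply: contrapT => nI'I.
  by apply: nI; exists (exist _ I' FI').
have [f fP] := choice step; pose u n := iter n f (exist _ I0 FI0).
have u_mono m n : (m <= n)%N -> sval (u m) `<=` sval (u n).
  move=> /subnK <-; elim: (n - m)%N => [|k IH] //=.
  by apply: subset_trans IH _; exact: (fP _).1.
have u_ideal n : is_ideal (sval (u n)) by apply/Fideal/svalP.
pose U := [set x | exists n, sval (u n) x].
have U_ideal : is_ideal U.
  split=> [|x y [m mx] [n ny]|a x [n nx]].
  - by exists 0%N; apply: ideal0.
  - exists (maxn m n); apply: idealD => //.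
      exact: u_mono (leq_maxl _ _) _ mx.
    exact: u_mono (leq_maxr _ _) _ ny.
  - by exists n; apply: ideal_mull.
have [s Us] := nR U U_ideal.
have [N sN] : exists N, forall x, x \in s -> sval (u N) x.
  have : forall x, x \in s -> U x by move=> x /mem_ideal_gen; rewrite Us.
  elim: (s) => [|x t IH] tU; first by exists 0%N.
  have [|N tN] := IH; first by move=> y yt; apply: tU; rewrite inE yt orbT.
  have [m mx] : U x by apply: tU; rewrite mem_head.
  exists (maxn m N) => y; rewrite inE => /predU1P[->|/tN yN].
    exact: u_mono (leq_maxl _ _) _ mx.
  exact: u_mono (leq_maxr _ _) _ yN.
apply: (fP (u N)).2 => x xN1; apply: (ideal_gen_sub (u_ideal N) sN).
by rewrite -Us; exists N.+1.
Qed.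

(** Maximality among the ideals generated by finite parts of [X]: adding one
    more element of [X] cannot enlarge the ideal. *)
Lemma noetherian_finite_span (X : set R) : noetherian R ->
  exists2 s : seq R, (forall x, x \in s -> X x) & X `<=` ideal_gen s.
Proof.
move=> nR.
pose F := [set I | exists2 s : seq R, (forall x, x \in s -> X x) &
                                      I = ideal_gen s].
have [||M [s sX ->] Mmax] := @noetherian_max F (ideal_gen [::]) nR.
- by move=> _ [s _ ->]; apply: ideal_genP.
- by exists [::].
exists s => // x Xx; apply: (Mmax (ideal_gen (x :: s))).
- by exists (x :: s) => // y; rewrite inE => /predU1P[->|/sX].
- apply: ideal_gen_sub; first exact: ideal_genP.
  by move=> y ys; apply: mem_ideal_gen; rewrite inE ys orbT.
- exact/mem_ideal_gen/mem_head.
Qed.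

(** * Zero divisors and prime avoidance *)

Definition nonzerodiv K x := forall y, K (x * y) -> K y.

Definition colon K y : set R := [set a | K (a * y)].

Lemma colon_ideal K y : is_ideal K -> is_ideal (colon K y).
Proof.
move=> hK; split=> [|a b|a b] /=; rewrite /colon /=.
- by rewrite mul0r; apply: ideal0.
- by rewrite mulrDl; apply: idealD.
- by rewrite -mulrA; apply: ideal_mull.
Qed.

Definition max_colon K y :=
  ~ K y /\
  forall z, ~ K z -> colon K y `<=` colon K z -> colon K z `<=` colon K y.

Lemma max_colon_prime K y : is_ideal K -> max_colon K y -> is_prime (colon K y).
Proof.
move=> hK [nKy ymax]; split; first exact: colon_ideal.
  by rewrite /colon /= mul1r.
move=> a b; rewrite /colon /= => Kaby; apply: contrapT => /not_orP[nKa nKb].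
apply: nKa; apply: (ymax (b * y)) => //; last by rewrite /colon /= mulrA.
by move=> c; rewrite /colon /= mulrCA; apply: ideal_mull.
Qed.

Lemma prime_prod P (x : seq R) :
  is_prime P -> (forall a, a \in x -> ~ P a) -> ~ P (\prod_(a <- x) a).
Proof.
move=> [_ P1 PM]; elim: x => [|a x IH] nP; first by rewrite big_nil.
rewrite big_cons => /PM[|]; first by apply/nP/mem_head.
by apply: IH => b bx; apply: nP; rewrite inE bx orbT.
Qed.

Lemma ideal_prod I (x : seq R) a :
  is_ideal I -> a \in x -> I a -> I (\prod_(b <- x) b).
Proof. by move=> hI ax Ia; rewrite (big_rem a) //=; apply: ideal_mulr. Qed.

(** The maximal colon ideals [(K : y)] are prime, and there are finitely many:
    if finitely many elements [y_i] generate all the elements with a maximal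
    colon ideal, then the colon ideal of any other one contains the
    intersection of the [(K : y_i)], hence, being prime, one of these, to which
    it is equal by maximality. *)
Lemma zero_divisors_finite_primes K : noetherian R -> is_ideal K ->
  exists Ps : seq (set R),
    (forall P, P \in Ps ->
       is_prime P /\ exists2 y, ~ K y & P = colon K y) /\
    (forall x, ~ nonzerodiv K x -> exists2 P, P \in Ps & P x).
Proof.
move=> nR hK; have [s smax smem] := noetherian_finite_span (max_colon K) nR.
exists (map (colon K) s); split.
  move=> _ /mapP[y ys ->]; have ymax := smax y ys.
  by split; [apply: max_colon_prime|exists y; case: ymax].
move=> x /existsNP[y /not_implyP[Kxy nKy]].
pose F := [set I | exists2 z, ~ K z & I = colon K z /\ colon K y `<=` I].
have [||M [z nKz [eM yM]] Mmax] := @noetherian_max F (colon K y) nR.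
- by move=> _ [z _ [-> _]]; apply: colon_ideal.
- by exists y => //; split=> //; apply: subset_refl.
rewrite {}eM in yM Mmax.
have zmax : max_colon K z.
  split=> // w nKw zw; apply: Mmax => //; exists w => //; split=> //.
  exact: (subset_trans yM zw).
suff [t ts tz] : exists2 t, t \in s & colon K t `<=` colon K z.
  have [nKt tmax] := smax t ts; exists (colon K t); first exact: map_f.
  by apply: (tmax z) => //; apply: yM.
apply: contrapT => none.
have pick t : exists a, t \in s -> K (a * t) /\ ~ K (a * z).
  case: (boolP (t \in s)) => ts; last by exists 0.
  apply: contrapT => nt; apply: none; exists t => // a Kat.
  by apply: contrapT => nKaz; apply: nt; exists a.
have [f fP] := choice pick.
apply: (@prime_prod (colon K z) (map f s)); first exact: max_colon_prime.
  by move=> _ /mapP[t ts ->]; case: (fP t ts).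
have [c ->] := smem z zmax.
rewrite /colon /= mulr_sumr; apply: ideal_sum => // i _.
rewrite mulrCA; apply: ideal_mull => //.
have ts := mem_nth 0 (ltn_ord i).
apply: (ideal_prod (colon_ideal _ hK) (map_f f ts)).
by case: (fP _ ts).
Qed.

Definition mul_add_closed I :=
  (forall x y, I x -> I y -> I (x + y)) /\
  (forall x y, I x -> I y -> I (x * y)).

Lemma mul_add_closed_prod I n (F : 'I_n.+1 -> R) :
  mul_add_closed I -> (forall i, I (F i)) -> I (\prod_i F i).
Proof.
move=> [_ IM]; elim: n F => [|n IH] F hF; first by rewrite big_ord1.
by rewrite big_ord_recl; apply: IM => //; apply: IH.
Qed.

(** The set [I] is not assumed to be an ideal, so that it may be the image in an
    overring of an ideal. Indexing by ['I_n.+1] serves the induction, which leaves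
    out one prime at a time. *)
Lemma prime_avoidance_ord n (P : 'I_n.+1 -> set R) I :
  mul_add_closed I -> (forall i, is_prime (P i)) -> (forall i, ~ I `<=` P i) ->
  exists2 x, I x & forall i, ~ P i x.
Proof.
move=> hI; elim: n P => [|n IH] P Pprime nIP.
  have [x /not_implyP[Ix nPx]] : exists x, ~ (I x -> P ord0 x).
    exact/existsNP/nIP.
  by exists x => // i; rewrite (ord1 i).
have pick i : exists x, I x /\ forall j, j != i -> ~ P j x.
  have [//|//|x Ix nPx] := IH (fun j => P (lift i j)); exists x; split=> // j.
  by case: (unliftP i j) => [k|] ->; rewrite ?eqxx.
have [x xP] := choice pick.
have [[i nPi]|allP] := pselect (exists i, ~ P i (x i)).
  exists (x i); first by case: (xP i).
  by move=> j; have [->|/((xP i).2 j)] := eqVneq j i.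
have {}allP i : P i (x i) by apply: contrapT => nPi; apply: allP; exists i.
(* Each [x i] lies in the prime [P i] and in no other one. *)
pose w := \prod_j x (lift ord0 j); exists (x ord0 + w).
  apply: hI.1; first by case: (xP ord0).
  by apply: mul_add_closed_prod => // j; case: (xP (lift ord0 j)).
have wE : w = \prod_(a <- map (fun j => x (lift ord0 j)) (enum 'I_n.+1)) a.
  by rewrite big_map big_enum.
move=> i; have hP : is_ideal (P i) by case: (Pprime i).
case: (unliftP ord0 i) hP => [j|] -> hP hsum.
  apply: ((xP ord0).2 (lift ord0 j)) => //.
  rewrite -(addrK w (x ord0)); apply: idealB => //; rewrite wE.
  apply: (@ideal_prod _ _ (x (lift ord0 j))) => //.
  by apply: (map_f (fun j => x (lift ord0 j))); rewrite mem_enum.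
have : ~ P ord0 w.
  rewrite wE; apply: prime_prod => // _ /mapP[j _ ->].
  exact: (xP (lift ord0 j)).2.
apply; rewrite -(addKr (x ord0) w); apply: idealD => //.
exact: idealN.
Qed.

Lemma prime_avoidance (Ps : seq (set R)) I : mul_add_closed I -> I !=set0 ->
  (forall P, P \in Ps -> is_prime P) -> (forall P, P \in Ps -> ~ I `<=` P) ->
  exists2 x, I x & forall P, P \in Ps -> ~ P x.
Proof.
case: Ps => [|P Ps] hI [x0 Ix0] Pprime nIP; first by exists x0.
have memP (i : 'I_(size Ps).+1) : nth P (P :: Ps) i \in P :: Ps.
  exact: mem_nth.
have [x Ix xP] := prime_avoidance_ord hI
  (fun i => Pprime _ (memP i)) (fun i => nIP _ (memP i)).
exists x => // Q QPs.
have lt_i : (index Q (P :: Ps) < (size Ps).+1)%N by rewrite -index_mem in QPs.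
by have := xP (Ordinal lt_i); rewrite /= nth_index.
Qed.

(** Prime avoidance applied to the finitely many primes that cover the zero
    divisors modulo the ideals of [Ks]. *)
Lemma nonzerodiv_or_colon (Ks : seq (set R)) I : noetherian R ->
  mul_add_closed I -> I !=set0 -> (forall K, K \in Ks -> is_ideal K) ->
  (exists2 z, I z & forall K, K \in Ks -> nonzerodiv K z) \/
  (exists K y, [/\ K \in Ks, ~ K y, is_prime (colon K y) & I `<=` colon K y]).
Proof.
move=> nR hI I0 Kideal.
have [Ps [Psprime Pscover]] : exists Ps : seq (set R),
    (forall P, P \in Ps -> is_prime P /\
      exists K y, [/\ K \in Ks, ~ K y & P = colon K y]) /\
    (forall K x, K \in Ks -> ~ nonzerodiv K x -> exists2 P, P \in Ps & P x).
  elim: Ks Kideal => [|K Ks IH] Kideal; first by exists [::].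
  have [|Ps [Psprime Pscover]] := IH.
    by move=> L LKs; apply: Kideal; rewrite inE LKs orbT.
  have [Qs [Qsprime Qscover]] :=
    zero_divisors_finite_primes nR (Kideal K (mem_head _ _)).
  exists (Qs ++ Ps); split=> [P|L x].
    rewrite mem_cat => /orP[].
      move=> /Qsprime[hP [y nKy eP]].
      by split=> //; exists K, y; rewrite mem_head.
    move=> /Psprime[hP [L [y [LK nKy eP]]]].
    by split=> //; exists L, y; rewrite inE LK orbT.
  rewrite inE => /predU1P[->|LKs] nzd.
    by have [P PQs Px] := Qscover x nzd; exists P => //; rewrite mem_cat PQs.
  have [P PPs Px] := Pscover L x LKs nzd.
  by exists P; rewrite // mem_cat PPs orbT.
have [[P PPs IP]|none] := pselect (exists2 P, P \in Ps & I `<=` P).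
  right; have [hP [K [y [KKs nKy eP]]]] := Psprime P PPs.
  by exists K, y; rewrite -eP.
have [z Iz zP] : exists2 z, I z & forall P, P \in Ps -> ~ P z.
  apply: prime_avoidance => // Q QPs; first by case: (Psprime Q QPs).
  by move=> IQ; apply: none; exists Q.
left; exists z => // K KKs; apply: contrapT => /(Pscover K z KKs)[P PPs Pz].
exact: zP Pz.
Qed.

End Ideals.

(** * Regular sequences modulo saturated ideals *)

Section Saturated.
Variable R : comPzRingType.
Implicit Types (S T I J K : set R) (s xs ys : seq R).

Definition mul_set S := S 1 /\ forall u v, S u -> S v -> S (u * v).

(** The [S]-saturated ideals are the contractions to [R] of the ideals of the ring
    of fractions [S^-1 R], for which they stand. *)
Definition sat_ideal S J := is_ideal J /\ forall u x, S u -> J (u * x) -> J x.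

Definition saturation S J : set R := [set x | exists2 u, S u & J (u * x)].

(** The contraction to [R] of the ideal generated by [J] and [x] in [S^-1 R]. *)
Definition adjoin S J x : set R :=
  [set w | exists u, S u /\ exists c, J (u * w - c * x)].

Definition adjoin_seq S J xs := foldl (adjoin S) J xs.

(** For a saturated ideal [J], this says that [xs] is a weakly regular sequence
    on [S^-1 (R / J)]. *)
Fixpoint sat_regular S J xs :=
  if xs is x :: xs' then nonzerodiv J x /\ sat_regular S (adjoin S J x) xs'
  else True.

(** For a local ring with maximal ideal [I], this is the vanishing of the depth of
    [R / K]. *)
Definition has_socle I K := exists2 y, ~ K y & I `<=` colon K y.

Lemma saturationP S J :
  mul_set S -> is_ideal J -> sat_ideal S (saturation S J).
Proof.
move=> [S1 SM] hJ; split; first split.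
- by exists 1; rewrite // mulr0; apply: ideal0.
- move=> x y [u Su hu] [v Sv hv]; exists (u * v); first exact: SM.
  have -> : u * v * (x + y) = v * (u * x) + u * (v * y) by ring.
  by apply: idealD => //; apply: ideal_mull.
- by move=> a x [u Su hu]; exists u; rewrite // mulrCA; apply: ideal_mull.
move=> u x Su [v Sv]; rewrite mulrA => hx.
by exists (v * u) => //; apply: SM.
Qed.

Section Adjoin.
Variable S : set R.
Hypothesis mulS : mul_set S.
Let S1 : S 1 := mulS.1.
Let SM u v : S u -> S v -> S (u * v) := mulS.2 u v.

Lemma adjoinP J x : is_ideal J -> sat_ideal S (adjoin S J x).
Proof.
move=> hJ; split; first split.
- exists 1; split=> //; exists 0.
  by rewrite mul0r mulr0 subr0; apply: ideal0.
- move=> y z [u [Su [c hy]]] [v [Sv [d hz]]].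
  exists (u * v); split; [exact: SM|exists (v * c + u * d)].
  have -> : u * v * (y + z) - (v * c + u * d) * x =
    v * (u * y - c * x) + u * (v * z - d * x) by ring.
  by apply: idealD => //; apply: ideal_mull.
- move=> a y [u [Su [c hy]]]; exists u; split=> //; exists (a * c).
  have -> : u * (a * y) - a * c * x = a * (u * y - c * x) by ring.
  exact: ideal_mull.
- move=> u y Su [v [Sv [c hy]]]; exists (v * u); split; first exact: SM.
  by exists c; rewrite -mulrA.
Qed.

Lemma sub_adjoin J x : J `<=` adjoin S J x.
Proof.
by move=> y Jy; exists 1; split=> //; exists 0; rewrite mul1r mul0r subr0.
Qed.

Lemma adjoinC_sub J x y :
  is_ideal J -> adjoin S (adjoin S J x) y `<=` adjoin S (adjoin S J y) x.
Proof.
move=> hJ w [u [Su [c [v [Sv [d h]]]]]].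
exists (v * u); split; first exact: SM.
exists d, 1; split=> //; exists (v * c).
by have -> : 1 * (v * u * w - d * x) - v * c * y =
  v * (u * w - c * y) - d * x by ring.
Qed.

Lemma adjoinC J x y :
  is_ideal J -> adjoin S (adjoin S J x) y = adjoin S (adjoin S J y) x.
Proof. by move=> hJ; apply/seteqP; split; apply: adjoinC_sub. Qed.

Lemma adjoin_seqC J x ys : is_ideal J ->
  adjoin_seq S (adjoin S J x) ys = adjoin S (adjoin_seq S J ys) x.
Proof.
elim: ys J => [//|y ys IH] J hJ /=.
by rewrite adjoinC // IH //; exact: (adjoinP _ hJ).1.
Qed.

Lemma adjoin_seqP J xs : sat_ideal S J -> sat_ideal S (adjoin_seq S J xs).
Proof.
by elim: xs J => [//|x xs IH] J [hJ _] /=; apply/IH/adjoinP.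
Qed.

Lemma sat_regular_rcons J xs x : sat_regular S J (rcons xs x) <->
  sat_regular S J xs /\ nonzerodiv (adjoin_seq S J xs) x.
Proof.
elim: xs J => [|y xs IH] J /=; first by split=> [[]|[]].
by rewrite IH; split=> [[? []]|[[]]].
Qed.

(** If [x w = c z] modulo [J], then [z c = 0] modulo [J] and [x], so that
    [c = d x] modulo [J]; now cancel [x] in [x w = d x z]. *)
Lemma nonzerodiv_adjoinC J x z : sat_ideal S J ->
  nonzerodiv J x -> nonzerodiv (adjoin S J x) z -> nonzerodiv (adjoin S J z) x.
Proof.
move=> [hJ satJ] Jx Jxz w [u [Su [c h]]].
have [v [Sv [d hd]]] : adjoin S J x c.
  apply: Jxz; exists 1; split=> //; exists (u * w).
  have -> : 1 * (z * c) - u * w * x = - (u * (x * w) - c * z) by ring.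
  exact: idealN.
exists (v * u); split; [exact: SM|exists d; apply: Jx].
have -> : x * (v * u * w - d * z) =
  v * (u * (x * w) - c * z) + z * (v * c - d * x) by ring.
by apply: idealD => //; apply: ideal_mull.
Qed.

(** The ideals modulo which the successive terms of [xs] must be regular,
    followed by the ideal that [J] and [xs] generate. *)
Definition prefix_ideals J xs := J :: scanl (adjoin S) J xs.

Lemma prefix_idealsP J xs K : sat_ideal S J ->
  K \in prefix_ideals J xs -> sat_ideal S K.
Proof.
rewrite /prefix_ideals; elim: xs J => [|x xs IH] J hJ /=.
  by rewrite inE => /eqP->.
by rewrite in_cons => /predU1P[-> //|]; apply/IH/adjoinP; case: hJ.
Qed.

Lemma sat_regular_adjoin J xs z : sat_ideal S J -> sat_regular S J xs ->
  (forall K, K \in prefix_ideals J xs -> nonzerodiv K z) ->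
  sat_regular S (adjoin S J z) xs /\ nonzerodiv (adjoin_seq S J xs) z.
Proof.
rewrite /prefix_ideals; elim: xs J => [|x xs IH] J hJ /=.
  by move=> _ zP; split=> //; apply: zP; rewrite inE.
move=> [Jx reg] zP; have hJx := adjoinP x hJ.1.
have Jxz : nonzerodiv (adjoin S J x) z.
  by apply: zP; rewrite !inE eqxx orbT.
have [|IH1 IH2] := IH _ hJx reg.
  by move=> K hK; apply: zP; rewrite in_cons hK orbT.
split=> //; split; first exact: nonzerodiv_adjoinC.
by rewrite adjoinC //; case: hJ.
Qed.

(** An ideal that precedes a term of [xs] has no socle, since this term, which is
    in [I], would kill the socle. *)
Lemma prefix_socle J xs K I : sat_ideal S J -> sat_regular S J xs ->
  (forall x, x \in xs -> I x) -> K \in prefix_ideals J xs -> has_socle I K ->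
  K = adjoin_seq S J xs.
Proof.
rewrite /prefix_ideals; elim: xs J => [|x xs IH] J hJ /=.
  by rewrite inE => _ _ /eqP.
move=> [Jx reg] xsI; rewrite in_cons => /predU1P[->|hK] soc.
  have [y nJy Iy] := soc; case: nJy; apply: Jx; apply: Iy.
  by apply: xsI; rewrite mem_head.
apply: IH => //; first by apply: adjoinP; case: hJ.
by move=> y yxs; apply: xsI; rewrite inE yxs orbT.
Qed.

(** If [I] kills [z] modulo [x], then in particular [y z = w x] modulo [J]. This
    relation is symmetric: [w] is not in [(y)] as [z] is not in [(x)], and
    [t z = d x] gives [x (t w) = y t z = x (d y)], whence [t w = d y]. *)
Lemma socle_exchange1 J I x y : sat_ideal S J -> nonzerodiv J x ->
  nonzerodiv J y -> I y -> has_socle I (adjoin S J x) ->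
  has_socle I (adjoin S J y).
Proof.
move=> [hJ satJ] Jx Jy Iy [z nz Iz].
have [u [Su [w hw]]] : adjoin S J x (y * z) by apply: Iz.
exists w.
  move=> [v [Sv [c hc]]]; apply: nz.
  exists (v * u); split; [exact: SM|exists c; apply: Jy].
  have -> : y * (v * u * z - c * x) =
    v * (u * (y * z) - w * x) + x * (v * w - c * y) by ring.
  by apply: idealD => //; apply: ideal_mull.
move=> t It; have [v [Sv [d hd]]] : adjoin S J x (t * z) by apply: Iz.
exists v; split=> //; exists (u * d); apply: Jx.
have -> : x * (v * (t * w) - u * d * y) =
  u * y * (v * (t * z) - d * x) - v * t * (u * (y * z) - w * x) by ring.
by apply: idealB => //; apply: ideal_mull.
Qed.

End Adjoin.

(** Two regular sequences of the same length in [I] are maximal together: both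
    are compared with a sequence ending in one element [z] of [I] that is
    regular modulo all the ideals in sight. Such a [z] may be moved to the front,
    which shortens the sequences to be compared by one. *)
Lemma socle_exchange S I n J xs ys : noetherian R -> mul_set S ->
  mul_add_closed I -> sat_ideal S J -> size xs = n -> size ys = n ->
  (forall x, x \in xs -> I x) -> (forall y, y \in ys -> I y) ->
  sat_regular S J xs -> sat_regular S J ys ->
  has_socle I (adjoin_seq S J xs) -> has_socle I (adjoin_seq S J ys).
Proof.
move=> nR mulS hI; elim: n J xs ys => [|n IH] J xs ys hJ.
  by move=> /size0nil-> /size0nil->.
case/lastP: xs => // xs x; case/lastP: ys => // ys y.
rewrite !size_rcons => -[szx] [szy] xsI ysI.
move=> /sat_regular_rcons[regx xreg] /sat_regular_rcons[regy yreg].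
have Ix : I x by apply: xsI; rewrite mem_rcons mem_head.
have Iy : I y by apply: ysI; rewrite mem_rcons mem_head.
have {}xsI a : a \in xs -> I a.
  by move=> axs; apply: xsI; rewrite mem_rcons inE axs orbT.
have {}ysI a : a \in ys -> I a.
  by move=> ays; apply: ysI; rewrite mem_rcons inE ays orbT.
rewrite /adjoin_seq !foldl_rcons -!/(adjoin_seq _ _ _) => soc.
pose Ks := prefix_ideals S J xs ++ prefix_ideals S J ys.
have no_socle K : K \in Ks -> ~ has_socle I K.
  rewrite mem_cat => /orP[] hK socK.
    have eK := prefix_socle mulS hJ regx xsI hK socK.
    by rewrite eK in socK; case: socK => a na Ia; apply/na/xreg/Ia.
  have eK := prefix_socle mulS hJ regy ysI hK socK.
  by rewrite eK in socK; case: socK => a na Ia; apply/na/yreg/Ia.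
have [||[z Iz zP]|[K [a [KKs na _ Ia]]]] :=
    @nonzerodiv_or_colon R Ks I nR hI.
- by exists x.
- by move=> K; rewrite mem_cat => /orP[]/(prefix_idealsP mulS hJ)[].
- have zPx K : K \in prefix_ideals S J xs -> nonzerodiv K z.
    by move=> hK; apply: zP; rewrite mem_cat hK.
  have zPy K : K \in prefix_ideals S J ys -> nonzerodiv K z.
    by move=> hK; apply: zP; rewrite mem_cat hK orbT.
  have [regxz xz] := sat_regular_adjoin mulS hJ regx zPx.
  have [regyz yz] := sat_regular_adjoin mulS hJ regy zPy.
  have hJx := adjoin_seqP mulS xs hJ; have hJy := adjoin_seqP mulS ys hJ.
  apply: (socle_exchange1 mulS hJy yz yreg Iy).
  rewrite -adjoin_seqC //; last by case: hJ.
  apply: (IH (adjoin S J z) xs ys) => //; first by apply: adjoinP; case: hJ.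
  rewrite adjoin_seqC //; last by case: hJ.
  exact: (socle_exchange1 mulS hJx xreg xz Iz).
- by case: (no_socle K KKs); exists a.
Qed.

(** A sequence longer than [xs] would have a beginning as long as [xs], which would
    have a socle by exchange, in spite of the next term. *)
Lemma sat_regular_size S I J xs ys : noetherian R -> mul_set S ->
  mul_add_closed I -> sat_ideal S J ->
  (forall x, x \in xs -> I x) -> (forall y, y \in ys -> I y) ->
  sat_regular S J xs -> sat_regular S J ys ->
  has_socle I (adjoin_seq S J xs) -> (size ys <= size xs)%N.
Proof.
move=> nR mulS hI hJ xsI ysI regx regy soc; rewrite leqNgt; apply/negP => lt_xy.
pose y0 := nth 0 ys (size xs); pose ys' := take (size xs) ys.
have eys : take (size xs).+1 ys = rcons ys' y0 by rewrite -take_nth.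
have {}regy : sat_regular S J (rcons ys' y0).
  rewrite -eys; elim: (ys) (size xs).+1 (J) regy => [|y t IH] [|k] L //=.
  by move=> [Ly reg]; split=> //; apply: IH.
have [regy' yreg] := (sat_regular_rcons S J ys' y0).1 regy.
have [||a na Ia] := socle_exchange nR mulS hI hJ erefl _ xsI _ regx regy' soc.
- by rewrite size_take lt_xy.
- by move=> y /mem_take; apply: ysI.
by apply/na/yreg/Ia/ysI/mem_nth.
Qed.

(** Regularity persists when more elements are inverted. *)
Lemma sat_regular_weaken S T J xs : mul_set S -> mul_set T -> S `<=` T ->
  sat_ideal S J -> sat_regular S J xs ->
  sat_regular T (saturation T J) xs /\
  adjoin_seq T (saturation T J) xs = saturation T (adjoin_seq S J xs).
Proof.
move=> mulS mulT sST; elim: xs J => [//|x xs IH] J hJ /= [Jx reg].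
have -> : adjoin T (saturation T J) x = saturation T (adjoin S J x).
  apply/seteqP; split=> w.
    move=> [u [Tu [c [v Tv h]]]]; exists (v * u); first exact: mulT.2.
    exists 1; split; [exact: mulS.1|exists (v * c)].
    by have -> : 1 * (v * u * w) - v * c * x = v * (u * w - c * x) by ring.
  move=> [u Tu [v [Sv [c h]]]]; exists (v * u).
  split; first by apply: mulT.2 => //; apply: sST.
  exists c, 1; first exact: mulT.1.
  by have -> : 1 * (v * u * w - c * x) = v * (u * w) - c * x by ring.
have [IH1 IH2] := IH _ (adjoinP mulS x hJ.1) reg.
split=> //; split=> // y [u Tu]; rewrite mulrCA => /Jx Jy.
by exists u.
Qed.

End Saturated.

(** * Suprema of sets of natural numbers *)

(** A supremum exists, so that [supremum] does not take its default value: it is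
    the maximum of a bounded nonempty set, and [+oo] for an unbounded set. *)
Lemma sup_nat_supremums (A : set nat) :
  supremums [set (k%:Z)%:E | k in A]%E (sup_nat A).
Proof.
rewrite /sup_nat /supremum; case: eqP => [->|/eqP/set0P[_ [k0 Ak0 _]]].
  by split=> [x []|x _]; rewrite ?leNye.
apply: xgetPex; have [[b bA]|unbounded] := pselect (exists b, ubound A b).
  have ex : exists k, `[< A k >] by exists k0; apply/asboolP.
  have ubA k : `[< A k >] -> (k <= b)%N by move/asboolP/bA.
  have [m /asboolP Am mmax] := ex_maxnP ex ubA.
  exists (m%:Z)%:E; split=> [_ [k Ak <-]|x ubx]; last by apply: ubx; exists m.
  by rewrite lee_fin lez_nat; apply/mmax/asboolP.
exists +oo%E; split=> [x _|x ubx]; first exact: leey.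
have large (k : nat) : exists2 l, A l & (k < l)%N.
  apply: contrapT => nl; apply: unbounded; exists k => l Al.
  by rewrite leNgt; apply/negP => kl; apply: nl; exists l.
case: x ubx => [z|//|] ubx.
  have [l Al zl] := large `|z|%N.
  have := ubx _ (ex_intro2 _ _ l Al erefl).
  rewrite lee_fin => lz; have := le_trans lz (ler_norm z).
  by rewrite -abszE lez_nat leqNgt zl.
by have := ubx _ (ex_intro2 _ _ k0 Ak0 erefl).
Qed.

Lemma sup_nat_ge (A : set nat) k : A k -> ((k%:Z)%:E <= sup_nat A)%E.
Proof. by move=> Ak; apply: (sup_nat_supremums A).1; exists k. Qed.

Lemma sup_nat_le (A : set nat) x :
  (forall k, A k -> ((k%:Z)%:E <= x)%E) -> (sup_nat A <= x)%E.
Proof.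
by move=> ubA; apply: (sup_nat_supremums A).2 => _ [k Ak <-]; apply: ubA.
Qed.

Lemma le_sup_nat (A A' : set nat) : A `<=` A' -> (sup_nat A <= sup_nat A')%E.
Proof. by move=> sAA'; apply: sup_nat_le => k /sAA'; apply: sup_nat_ge. Qed.

(** * Localization at a prime *)

Section Loc.
Variables (R : comPzRingType) (P : spec R).
Local Notation S := (~` spec_set P).
Local Notation iota := (loc_inj P).

Lemma prime_compl_mul_set : mul_set S.
Proof.
by split=> [|u v]; [case: (specP P)|apply: spec_notM].
Qed.

Lemma loc_injD a b : iota (a + b) = iota a + iota b.
Proof.
rewrite -[RHS]/(add_loc (iota a) (iota b)) /loc_inj -pi_add_loc.
by apply: frac_eq => /=; ring.
Qed.

Lemma loc_injM a b : iota (a * b) = iota a * iota b.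
Proof.
rewrite -[RHS]/(mul_loc (iota a) (iota b)) /loc_inj -pi_mul_loc.
by apply: frac_eq => /=; ring.
Qed.

Lemma loc_inj1 : iota 1 = 1. Proof. by []. Qed.

Lemma loc_inj0 : iota 0 = 0. Proof. by []. Qed.

Lemma loc_injB a b : iota (a - b) = iota a - iota b.
Proof. by apply/eqP; rewrite -subr_eq opprK -loc_injD subrK. Qed.

Lemma loc_inj_eq0 a : iota a = 0 <-> exists2 u, S u & u * a = 0.
Proof.
split=> [/pi_locP|[u Su ua]]; last apply/pi_locP.
  by move=> [u Su] /=; rewrite mul0r subr0 mulr1; exists u.
by exists u => //=; rewrite mul0r subr0 mulr1.
Qed.

Lemma loc_inj_unit u : S u -> is_unit (iota u).
Proof.
move=> Su; exists (\pi_(loc P) (mkfrac 1 Su)).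
rewrite -[LHS]/(mul_loc _ _) /loc_inj -pi_mul_loc.
by apply: frac_eq => /=; ring.
Qed.

Lemma loc_fraction z : exists a u, S u /\ z * iota u = iota a.
Proof.
elim/quotW: z => -[[a u] /=] Pu; have Su := elimT (asboolPn _) Pu.
exists a, u; split=> //; set z := exist _ _ _.
rewrite -[LHS]/(mul_loc _ _) /loc_inj -pi_mul_loc.
by apply: frac_eq => /=; ring.
Qed.

Lemma loc_inj_nonunit a : P a -> ~ is_unit (iota a).
Proof.
have [hP P1 PM] := specP P.
move=> Pa [z za1]; have [b [u [Su zu]]] := loc_fraction z.
have /loc_inj_eq0[v Sv] : iota (a * b - u) = 0.
  by rewrite loc_injB loc_injM -zu mulrA za1 mul1r subrr.
move=> vabu; case: (PM v u) => //; rewrite -[v * u](subKr (v * (a * b))).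
rewrite -mulrBr vabu subr0; apply: ideal_mull => //; exact: ideal_mulr.
Qed.

Lemma ideal_unit (I : set (loc P)) u z :
  is_ideal I -> S u -> I (z * iota u) -> I z.
Proof.
move=> hI /loc_inj_unit[w uw] /(ideal_mulr w hI).
by rewrite -mulrA uw mulr1.
Qed.

Definition contracts_to (I : set (loc P)) (J : set R) :=
  forall a, I (iota a) <-> J a.

(** For [S = {1}] all ideals are saturated and [sat_regular] is ordinary weak
    regularity; the definition of depth enters in this form. *)
Lemma triv_mul_set (Q : comPzRingType) : mul_set [set 1 : Q].
Proof. by split=> // _ _ -> ->; rewrite mulr1. Qed.

Lemma zero_contracts : contracts_to [set 0] (saturation S [set 0]).
Proof. exact: loc_inj_eq0. Qed.

(** Since [x] is a numerator of [z], the two generate the same ideal of the local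
    ring. *)
Lemma adjoin_contracts I J z u x : is_ideal I -> sat_ideal S J ->
  contracts_to I J -> S u -> z * iota u = iota x ->
  contracts_to (adjoin [set 1] I z) (adjoin S J x).
Proof.
move=> hI [hJ satJ] IJ Su zu a; split.
  move=> [_ [-> [c]]]; rewrite mul1r => h.
  have [d [v [Sv cv]]] := loc_fraction c.
  exists (v * u); split; first exact: spec_notM.
  exists d; apply/IJ; rewrite loc_injB !loc_injM -cv -zu.
  have -> : iota v * iota u * iota a - c * iota v * (z * iota u) =
    (iota v * iota u) * (iota a - c * z) by ring.
  exact: ideal_mull.
move=> [v [Sv [c /IJ]]]; rewrite loc_injB !loc_injM -zu => h.
have [w vw] := loc_inj_unit Sv.
exists 1; split=> //; exists (w * iota c * iota u); rewrite mul1r.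
have -> : iota a - w * iota c * iota u * z =
  w * (iota v * iota a - iota c * (z * iota u)) + (1 - iota v * w) * iota a.
  by ring.
by rewrite vw subrr mul0r addr0; apply: ideal_mull.
Qed.

Lemma nonzerodiv_contracts I J z u x : is_ideal I ->
  contracts_to I J -> S u -> z * iota u = iota x ->
  nonzerodiv I z <-> nonzerodiv J x.
Proof.
move=> hI IJ Su zu; split=> [Iz a /IJ|Jx w hw].
  rewrite loc_injM -zu -mulrA => /Iz h; apply/IJ.
  by apply: ideal_unit Su _ => //; rewrite mulrC.
have [b [v [Sv wv]]] := loc_fraction w.
apply: (ideal_unit hI Sv); rewrite wv; apply/IJ/Jx/IJ.
rewrite loc_injM -zu -wv.
have -> : z * iota u * (w * iota v) = iota u * iota v * (z * w) by ring.
exact: ideal_mull.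
Qed.

Lemma loc_regular I J xs : is_ideal I -> sat_ideal S J ->
  contracts_to I J -> sat_regular S J xs ->
  sat_regular [set 1] I (map iota xs).
Proof.
elim: xs I J => [//|x xs IH] I J hI hJ IJ /= [Jx reg].
have S1 := prime_compl_mul_set.1.
have x1 : iota x * iota 1 = iota x by rewrite mulr1.
split; first exact/(nonzerodiv_contracts hI IJ S1 x1).
apply: IH reg.
- exact: (adjoinP (triv_mul_set _) _ hI).1.
- exact: (adjoinP prime_compl_mul_set _ hJ.1).
- exact: adjoin_contracts x1.
Qed.

Lemma loc_regular_numerators I J zs : is_ideal I -> sat_ideal S J ->
  contracts_to I J -> (forall z, z \in zs -> ~ is_unit z) ->
  sat_regular [set 1] I zs ->
  exists xs, [/\ size xs = size zs, forall x, x \in xs -> P x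
               & sat_regular S J xs].
Proof.
elim: zs I J => [|z zs IH] I J hI hJ IJ nunit /=; first by exists [::].
move=> [Iz reg]; have [x [u [Su zu]]] := loc_fraction z.
have [|||z' z'zs||xs [sz xsP regxs]] :=
  IH (adjoin [set 1] I z) (adjoin S J x).
- exact: (adjoinP (triv_mul_set _) _ hI).1.
- exact: (adjoinP prime_compl_mul_set _ hJ.1).
- exact: adjoin_contracts zu.
- by apply: nunit; rewrite inE z'zs orbT.
- exact: reg.
exists (x :: xs); split=> /=; first by rewrite sz.
- move=> y; rewrite inE => /predU1P[->|/xsP//].
  apply: contrapT => /loc_inj_unit[w xw]; apply: (nunit z).
    by rewrite mem_head.
  by exists (iota u * w); rewrite mulrA zu.
- by split=> //; apply/(nonzerodiv_contracts hI IJ Su zu).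
Qed.

End Loc.

(** * Weakly regular sequences without denominators *)

Lemma zero_ideal (R : comPzRingType) : is_ideal [set 0 : R].
Proof.
split=> [//|_ _ -> ->|a _ ->]; first by rewrite addr0.
by rewrite mulr0.
Qed.

Lemma ideal_gen_rcons (R : comPzRingType) (s : seq R) x :
  ideal_gen (rcons s x) = adjoin [set 1] (ideal_gen s) x.
Proof.
apply/seteqP; split.
  apply: ideal_gen_sub.
    exact: (adjoinP (triv_mul_set _) _ (ideal_genP s)).1.
  move=> y; rewrite mem_rcons inE => /predU1P[->|ys].
    exists 1; split=> //; exists 1; rewrite subrr.
    exact: ideal0 (ideal_genP s).
  apply: sub_adjoin; first exact: triv_mul_set.
  exact: mem_ideal_gen.
move=> w [_ [-> [c]]]; rewrite mul1r => h.
rewrite -(subrK (c * x) w); have gP := ideal_genP (rcons s x).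
apply: idealD => //; last first.
  by apply: ideal_mull => //; apply: mem_ideal_gen; rewrite mem_rcons mem_head.
move: h; apply: ideal_gen_sub => // y ys; apply: mem_ideal_gen.
by rewrite mem_rcons inE ys orbT.
Qed.

Lemma ideal_gen_adjoin (R : comPzRingType) (s : seq R) :
  ideal_gen s = adjoin_seq [set 1] [set 0] s.
Proof.
elim/last_ind: s => [|s x IH].
  apply/seteqP; split=> [|_ ->]; last exact: ideal0 (ideal_genP _).
  by apply: ideal_gen_sub => //; apply: zero_ideal.
by rewrite ideal_gen_rcons IH /adjoin_seq foldl_rcons.
Qed.

Lemma regular_prefixE (R : comPzRingType) (s : seq R) :
  (forall i, (i < size s)%N -> nonzerodiv (ideal_gen (take i s)) s`_i) <->
  sat_regular [set 1] [set 0] s.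
Proof.
elim/last_ind: s => [|s x IH]; first by split.
rewrite sat_regular_rcons -IH -ideal_gen_adjoin size_rcons; split.
  move=> reg; split=> [i lt_i|].
    have := reg i (ltnW lt_i); rewrite nth_rcons lt_i.
    by rewrite -cats1 takel_cat // ltnW.
  have := reg (size s) (ltnSn _); rewrite nth_rcons ltnn eqxx.
  by rewrite -cats1 take_size_cat.
move=> [reg regx] i; rewrite ltnS leq_eqVlt => /predU1P[->|lt_i].
  by rewrite nth_rcons ltnn eqxx -cats1 take_size_cat.
by rewrite nth_rcons lt_i -cats1 takel_cat ?(ltnW lt_i) //; apply: reg.
Qed.

(** * Depth and dimension of a local ring *)

Section LocDepth.
Variables (R : comPzRingType) (P : spec R).
Local Notation S := (~` spec_set P).

Let zeroS : sat_ideal S (saturation S [set 0]).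
Proof. exact/saturationP/zero_ideal/prime_compl_mul_set. Qed.

Lemma adjoin_seq_sub_prime J xs : J `<=` spec_set P ->
  (forall x, x \in xs -> P x) -> adjoin_seq S J xs `<=` spec_set P.
Proof.
have [hP _ PM] := specP P.
elim: xs J => [//|x xs IH] J JP xsP; apply: IH; last first.
  by move=> y yxs; apply: xsP; rewrite inE yxs orbT.
move=> w [u [Su [c /JP h]]]; case: (PM u w) => //.
rewrite -(subrK (c * x) (u * w)); apply: idealD => //.
by apply: ideal_mull => //; apply: xsP; rewrite mem_head.
Qed.

Lemma adjoin_seq_contracts I J xs : is_ideal I -> sat_ideal S J ->
  contracts_to I J ->
  contracts_to (adjoin_seq [set 1] I (map (loc_inj P) xs)) (adjoin_seq S J xs).
Proof.
elim: xs I J => [//|x xs IH] I J hI hJ IJ /=; apply: IH.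
- exact: (adjoinP (triv_mul_set _) _ hI).1.
- exact: (adjoinP (prime_compl_mul_set P) _ hJ.1).
- apply: (adjoin_contracts hI hJ IJ (prime_compl_mul_set P).1).
  by rewrite mulr1.
Qed.

Lemma depth_ge xs : (forall x, x \in xs -> P x) ->
  sat_regular S (saturation S [set 0]) xs ->
  (((size xs)%:Z)%:E <= depth (loc P))%E.
Proof.
move=> xsP reg; apply: sup_nat_ge; exists (map (loc_inj P) xs).
have zeroP := zero_ideal (loc P); split; first by rewrite size_map.
  by move=> _ /mapP[x /xsP Px ->]; apply: loc_inj_nonunit.
split; first exact/regular_prefixE/(loc_regular zeroP zeroS (zero_contracts P)).
rewrite ideal_gen_adjoin -loc_inj1.
move/(adjoin_seq_contracts _ zeroP zeroS (zero_contracts P)).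
have [hP P1 PM] := specP P.
move/adjoin_seq_sub_prime => h; apply: P1; apply: h => // x [u Su ux].
by case: (PM u x); rewrite // ux; apply: ideal0.
Qed.

(** Replacing fractions by their numerators turns any regular sequence of the local
    ring into a sequence of elements of [P], to be compared with [xs]. *)
Lemma depth_le xs : noetherian R -> (forall x, x \in xs -> P x) ->
  sat_regular S (saturation S [set 0]) xs ->
  has_socle P (adjoin_seq S (saturation S [set 0]) xs) ->
  (depth (loc P) <= ((size xs)%:Z)%:E)%E.
Proof.
move=> nR xsP reg soc; apply: sup_nat_le => k [zs [<- nunit [regz _]]].
have [ys [<- ysP regy]] := loc_regular_numerators (zero_ideal _) zeroS
  (zero_contracts P) nunit ((regular_prefixE _).1 regz).
rewrite lee_fin lez_nat.
apply: (sat_regular_size nR (prime_compl_mul_set P) _ zeroS xsP ysP reg regy).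
  have [hP _ _] := specP P.
  by split=> x y; [apply: idealD|move=> Px _; apply: ideal_mulr].
by [].
Qed.

Lemma loc_contraction (q : spec (loc P)) :
  is_prime [set a | q (loc_inj P a)].
Proof.
have [hq q1 qM] := specP q; split=> [||a b] /=; first split=> [|a b|a b] /=.
- by rewrite loc_inj0; apply: ideal0.
- by rewrite loc_injD; apply: idealD.
- by rewrite loc_injM; apply: ideal_mull.
- by rewrite loc_inj1.
- by rewrite loc_injM; apply: qM.
Qed.

Definition loc_extension (q : set R) : set (loc P) :=
  [set z | exists a u, [/\ q a, S u & z * loc_inj P u = loc_inj P a]].

Lemma loc_extension_inj (q : spec R) a : spec_set q `<=` spec_set P ->
  loc_extension q (loc_inj P a) <-> q a.
Proof.
have [hq q1 qM] := specP q => qP; split; last first.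
  move=> qa; exists a, 1; split=> //; first exact: (prime_compl_mul_set P).1.
  by rewrite loc_inj1 mulr1.
move=> [b [u [qb Su]]]; rewrite -loc_injM => e.
have /loc_inj_eq0[v Sv] : loc_inj P (a * u - b) = 0.
  by rewrite loc_injB e subrr.
move=> vaub; have : q (v * u * a).
  have -> : v * u * a = v * (a * u - b) + v * b by ring.
  by rewrite vaub add0r; apply: ideal_mull.
by case/qM => // /qM[]/qP.
Qed.

Lemma loc_extension_prime (q : spec R) :
  spec_set q `<=` spec_set P -> is_prime (loc_extension q).
Proof.
have [hq q1 qM] := specP q => qP; split.
- split.
  + exists 0, 1; split; rewrite ?mul0r //; first exact: ideal0.
    exact: (prime_compl_mul_set P).1.
  + move=> y z [a [u [qa Su yu]]] [b [v [qb Sv zv]]].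
    exists (a * v + b * u), (u * v); split; last first.
    * by rewrite loc_injD !loc_injM -yu -zv; ring.
    * exact: spec_notM.
    * by apply: idealD => //; apply: ideal_mulr.
  + move=> y z [a [u [qa Su zu]]]; have [b [v [Sv yv]]] := loc_fraction y.
    exists (b * a), (v * u); split; first exact: ideal_mull.
      exact: spec_notM.
    by rewrite !loc_injM -zu -yv; ring.
- by rewrite -loc_inj1; move/(loc_extension_inj _ qP).
- move=> y z [a [u [qa Su yzu]]].
  have [b [v [Sv yv]]] := loc_fraction y.
  have [c [w [Sw zw]]] := loc_fraction z.
  have /qM[/qM[qb|qc]|qu] : q (b * c * u).
  + apply/(loc_extension_inj _ qP); exists (v * w * a), 1; split.
    * exact: ideal_mull.
    * exact: (prime_compl_mul_set P).1.
    * by rewrite !loc_injM -yv -zw -yzu loc_inj1; ring.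
  + by left; exists b, v.
  + by right; exists c, w.
  + by case: Su; apply: qP.
Qed.

Lemma krull_dim_locE : krull_dim (loc P) =
  sup_nat [set k | exists c : 'I_k.+1 -> spec R,
    prime_chain c /\ forall i, spec_set (c i) `<=` spec_set P].
Proof.
congr sup_nat; apply/seteqP; split=> k.
  move=> [c chain]; exists (fun i => Spec (loc_contraction (c i))); split.
    move=> i j /chain[cij ncji]; split=> [a|h]; first exact: cij.
    apply: ncji => z cz; have [a [u [Su zu]]] := loc_fraction z.
    have [hci _ _] := specP (c i); have [hcj _ _] := specP (c j).
    apply: (ideal_unit hci Su); rewrite zu; apply: h => /=.
    by rewrite -zu; apply: ideal_mulr.
  move=> i a /= cia; apply: contrapT => /loc_inj_unit[w aw].
  have [hci ci1 _] := specP (c i).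
  by apply: ci1; rewrite -aw; apply: ideal_mulr.
move=> [c [chain cP]]; exists (fun i => Spec (loc_extension_prime (cP i))).
move=> i j /chain[cij ncji]; split=> [z [a [u [qa Su zu]]]|h] /=.
  by exists a, u; split=> //; apply: cij.
apply: ncji => a cja; apply/(loc_extension_inj a (cP i))/h.
exact/(loc_extension_inj a (cP j)).
Qed.

End LocDepth.

(** * Descent along a retraction *)

Section Retraction.
Variables (A B : comPzRingType) (f : {rmorphism A -> B}) (rho : B -> A).
Hypothesis rhoD : forall x y, rho (x + y) = rho x + rho y.
Hypothesis rhoM : forall a x, rho (f a * x) = a * rho x.
Hypothesis rho1 : rho 1 = 1.

Let rhoK a : rho (f a) = a.
Proof. by rewrite -[f a]mulr1 rhoM rho1 mulr1. Qed.

Let rho0 : rho 0 = 0.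
Proof. by rewrite -(rmorph0 f) rhoK. Qed.

Let rhoB x y : rho (x - y) = rho x - rho y.
Proof. by apply/eqP; rewrite -subr_eq opprK -rhoD subrK. Qed.

Lemma retract_noetherian : noetherian B -> noetherian A.
Proof.
move=> nB I hI; have [s sI Is] := noetherian_finite_span (f @` I) nB.
exists (map rho s); apply/seteqP; split; last first.
  apply: ideal_gen_sub => // _ /mapP[_ /sI[a Ia <-] ->].
  by rewrite rhoK.
move=> a Ia; have [c fa] := Is _ (ex_intro2 _ _ a Ia erefl).
rewrite -(rhoK a) fa (big_morph rho rhoD rho0).
apply: ideal_sum => [|i _]; first exact: ideal_genP.
have si := mem_nth 0 (ltn_ord i); have [b Ib sb] := sI _ si.
rewrite -sb mulrC rhoM; apply: ideal_mulr; first exact: ideal_genP.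
by apply: mem_ideal_gen; rewrite -(rhoK b) sb map_f.
Qed.

Definition lies_over (Q : spec B) (p : spec A) := forall a, Q (f a) <-> p a.

(** An ideal of [B] maximal among those that meet [A] inside [p] and contain the
    elements of [p] is prime. Such ideals exist: the largest ideal that the
    retraction maps into [p] is one. *)
Lemma retract_lying_over (p : spec A) : noetherian B -> exists Q, lies_over Q p.
Proof.
move=> nB; have [hp p1 pM] := specP p.
pose F (J : set B) := [/\ is_ideal J, forall a, J (f a) -> p a
                                    & forall a, p a -> J (f a)].
have FJ0 : F [set b | forall c, p (rho (c * b))].
  split=> [|a /(_ 1)|a pa c /=]; last 2 first.
  - by rewrite mul1r rhoK.
  - by rewrite mulrC rhoM; apply: ideal_mulr.
  split=> [c|x y hx hy c|a x hx c] /=.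
  - by rewrite mulr0 rho0; apply: ideal0.
  - by rewrite mulrDr rhoD; apply: idealD.
  - by rewrite mulrA.
have [|M [hM Mp pM'] Mmax] := noetherian_max nB _ FJ0; first by move=> I [].
have meets x : ~ M x -> exists a c, ~ p a /\ M (f a - c * x).
  move=> nMx; apply: contrapT => none; apply: nMx.
  apply: (Mmax [set w | exists c, M (w - c * x)]).
  - split; first split.
    + by exists 0; rewrite mul0r subr0; apply: ideal0.
    + move=> y z [c hy] [d hz]; exists (c + d).
      have -> : y + z - (c + d) * x = (y - c * x) + (z - d * x) by ring.
      exact: idealD.
    + move=> a y [c hy]; exists (a * c).
      have -> : a * y - a * c * x = a * (y - c * x) by ring.
      exact: ideal_mull.
    + move=> a [c h]; apply: contrapT => npa; apply: none.
      by exists a, c.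
    + by move=> a /pM' Ma; exists 0; rewrite mul0r subr0.
  - by move=> y My; exists 0; rewrite mul0r subr0.
  - by exists 1; rewrite mul1r subrr; apply: ideal0.
have Mprime : is_prime M.
  split=> //; first by rewrite -(rmorph1 f) => /Mp.
  move=> x y Mxy; apply: contrapT => /not_orP[/meets[a [c [npa hx]]]].
  move=> /meets[b [d [npb hy]]].
  have /Mp /pM[] // : M (f (a * b)).
  have -> : f (a * b) =
    f b * (f a - c * x) + c * x * (f b - d * y) + c * d * (x * y).
    by rewrite rmorphM; ring.
  by do 2?[apply: idealD => //]; apply: ideal_mull.
by exists (Spec Mprime) => a; split; [apply: Mp|apply: pM'].
Qed.

(** By linearity the retraction maps the ideal of [B] generated by elements of [A]
    back into the ideal of [A] that they generate. *)
Lemma retract_regular (S : set A) (J : set A) (K : set B) xs :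
  (forall a, J a -> K (f a)) -> (forall b, K b -> J (rho b)) ->
  sat_regular (f @` S) K (map f xs) -> sat_regular S J xs.
Proof.
elim: xs J K => [//|x xs IH] J K JK KJ /= [Kx reg]; split.
  by move=> a /JK; rewrite rmorphM => /Kx/KJ; rewrite rhoK.
apply: IH reg => [a|b].
  move=> [u [Su [c /JK h]]]; exists (f u); split; first by exists u.
  by exists (f c); rewrite -!rmorphM -rmorphB.
move=> [_ [[u Su <-] [c /KJ]]]; rewrite rhoB rhoM mulrC [c * _]mulrC rhoM => h.
by exists u; split=> //; exists (rho c); rewrite mulrC [rho c * _]mulrC.
Qed.

(** The usual going-down property: the upper prime of [A] is the contraction of
    [Q]. *)
Definition going_down := forall (p : spec A) (Q : spec B),
  (forall a, p a -> Q (f a)) ->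
  exists Q', lies_over Q' p /\ spec_set Q' `<=` spec_set Q.

(** A chain of primes in [p] is lifted to a chain in [Q] from the top down; the
    inclusions stay strict because the contractions differ. *)
Lemma going_down_krull_dim (p : spec A) (Q : spec B) : going_down ->
  lies_over Q p -> (krull_dim (loc p) <= krull_dim (loc Q))%E.
Proof.
move=> gd Qp; rewrite !krull_dim_locE; apply: le_sup_nat => k [c [chain cp]].
have pick (q : spec A * spec B) : exists Q', (forall a, q.1 a -> q.2 (f a)) ->
    lies_over Q' q.1 /\ spec_set Q' `<=` spec_set q.2.
  have [/gd[Q' hQ']|nq] := pselect (forall a, q.1 a -> q.2 (f a)).
    by exists Q'.
  by exists q.2 => /nq.
have [g gP] := choice pick.
(* [F] descends: [F 0] is [Q], and [F i.+1] lies over the term of index [k - i]. *)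
pose F := fix F i := if i is j.+1 then g (c (inord (k - j)), F j) else Q.
have FP i : (i <= k)%N ->
    lies_over (F i.+1) (c (inord (k - i))) /\
    spec_set (F i.+1) `<=` spec_set (F i).
  elim: i => [_|i IH lt_ik] /=.
    by apply: gP => /= a ca; apply/Qp/(cp _ _ ca).
  have [/= over _] := IH (ltnW lt_ik); apply: gP => /= a ca; apply/over.
  apply: (chain (inord (k - i.+1)) (inord (k - i)) _).1 => //.
  by rewrite !inordK ?ltnS ?leq_subr // ltn_sub2l.
have Fmono i j : (i <= j <= k.+1)%N -> spec_set (F j) `<=` spec_set (F i).
  case/andP => /subnK <-; elim: (j - i)%N => [_ x //|m IH].
  rewrite addSn ltnS => lek; apply: subset_trans (IH (leqW lek)).
  exact: (FP _ lek).2.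
exists (fun i : 'I_k.+1 => F (k - i).+1).
have over (i : 'I_k.+1) : lies_over (F (k - i).+1) (c i).
  have := (FP (k - i)%N (leq_subr _ _)).1.
  by rewrite subKn ?inord_val // -ltnS.
split=> [i j lt_ij|i]; last first.
  by apply: (Fmono 0%N); rewrite /= ltnS leq_subr.
split; first by apply: Fmono; rewrite !ltnS leq_sub2l ?leq_subr // ltnW.
move=> sFji; have [_ ncji] := chain i j lt_ij; apply: ncji => a cja.
by apply/over/sFji/over.
Qed.

(** While some element of [p] is regular modulo the sequence already found in
    [p], that sequence gets longer. When none is, [p] consists of zero divisors,
    so some associated prime [Q] of the quotient of [B_p] by the sequence lies
    over [p]. The sequence is then maximal in [B_Q], whence
    [depth B_Q <= size xs <= depth A_p], and [dim A_p <= dim B_Q]. *)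
Lemma retract_serre n : noetherian B -> going_down -> serre n B -> serre n A.
Proof.
move=> nB gd [_ serreB]; split=> [|p]; first exact: retract_noetherian.
have [hp p1 pM] := specP p.
pose S := f @` (~` spec_set p).
have mulS : mul_set S.
  split; first by exists 1; rewrite ?rmorph1.
  move=> _ _ [a pa <-] [b pb <-]; exists (a * b); last by rewrite rmorphM.
  exact: spec_notM.
pose J0 := saturation S [set 0 : B].
have hJ0 : sat_ideal S J0 := saturationP mulS (@zero_ideal B).
have depth_p xs : (forall x, x \in xs -> p x) ->
    sat_regular S J0 (map f xs) -> (((size xs)%:Z)%:E <= depth (loc p))%E.
  move=> xsp reg; apply: depth_ge => //; apply: retract_regular reg.
    move=> a [u pu ua]; exists (f u); first by exists u.
    by rewrite -rmorphM ua rmorph0.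
  by move=> b [_ [u pu <-] ub]; exists u; rewrite //= -rhoM ub rho0.
suff [[xs [<- xsp reg]]|//] :
    (exists xs, [/\ size xs = n, forall x, x \in xs -> p x
                 & sat_regular S J0 (map f xs)])
    \/ (mine (n%:Z)%:E (krull_dim (loc p)) <= depth (loc p))%E.
  by rewrite ge_min depth_p.
suff ext k : (exists xs, [/\ size xs = k, forall x, x \in xs -> p x
                 & sat_regular S J0 (map f xs)])
    \/ (mine (n%:Z)%:E (krull_dim (loc p)) <= depth (loc p))%E by apply: ext.
elim: k => [|k [[xs [szx xsp reg]]|]]; [by left; exists [::]| |by right].
pose K := adjoin_seq S J0 (map f xs).
have [hK satK] : sat_ideal S K := adjoin_seqP mulS _ hJ0.
have [|||[_ [a pa <-] zP]|[L [y [LK nLy Lprime pL]]]] :=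
  @nonzerodiv_or_colon B [:: K] (f @` p) nB.
- split=> _ _ [a pa <-] [b pb <-].
    by exists (a + b); [apply: idealD|rewrite rmorphD].
  by exists (a * b); [apply: ideal_mull|rewrite rmorphM].
- by exists (f 0), 0 => //; apply: ideal0.
- by move=> L; rewrite inE => /eqP ->.
- left; exists (rcons xs a); split; first by rewrite size_rcons szx.
    by move=> x; rewrite mem_rcons inE => /predU1P[->|/xsp].
  rewrite map_rcons; apply/sat_regular_rcons; split=> //.
  by apply: zP; rewrite inE.
right; move: LK; rewrite inE => /eqP eL; rewrite {L}eL in nLy Lprime pL.
pose Q := Spec Lprime; pose T := ~` spec_set Q.
have Qp : lies_over Q p.
  move=> a; split=> [Qa|pa]; last by apply: pL; exists a.
  apply: contrapT => npa; apply: nLy; apply: satK Qa.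
  by exists a.
have sST : S `<=` T by move=> _ [a npa <-] /Qp.
have mulT : mul_set T := prime_compl_mul_set Q.
have eJ0 : saturation T J0 = saturation T [set 0].
  apply/seteqP; split=> x [u Tu].
    move=> [v Sv vux]; exists (v * u); last by rewrite -mulrA.
    by apply: mulT.2 => //; apply: sST.
  by move=> ux; exists u => //; exists 1; [case: mulS|rewrite mul1r].
have [regT eK] := sat_regular_weaken mulS mulT sST hJ0 reg.
rewrite eJ0 -/K in regT eK.
have depthQ : (depth (loc Q) <= ((size xs)%:Z)%:E)%E.
  rewrite -(size_map f xs); apply: depth_le => //.
    by move=> _ /mapP[x /xsp px ->]; apply/Qp.
  rewrite eK; exists y; first by move=> [u Tu Kuy]; apply: Tu.
  by move=> a Qa; exists 1; [case: mulT|rewrite mul1r].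
apply: le_trans (depth_p xs xsp reg); apply: le_trans depthQ.
apply: le_trans (serreB Q); rewrite le_min !ge_min lexx /=.
by rewrite going_down_krull_dim ?orbT.
Qed.

End Retraction.

(** * Rings of invariants *)

Section Invariants.
Variables (G : finGroupType) (B : comPzRingType) (act : ring_action G B).
Local Notation A := (invariants act).

Lemma invariant_fix (a : A) g : act g (val a) = val a.
Proof. exact/invariantP/valP. Qed.

Lemma act_reindex (idx : B) (op : Monoid.com_law idx) b h :
  \big[op/idx]_(g : G) act h (act g b) = \big[op/idx]_(g : G) act g b.
Proof.
rewrite [RHS](reindex_inj (mulgI h)); apply: eq_bigr => g _.
by rewrite ractM.
Qed.

Lemma norm_invariant b : \prod_(g : G) act g b \in Defs.invariant act.
Proof.
apply/invariantP => h; rewrite rmorph_prod.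
exact: act_reindex.
Qed.

(** If [p] lies in the contraction of [Q] and [Q1] is a prime over [p], then some
    conjugate of [Q1] is contained in [Q]: otherwise prime avoidance gives an
    element of [Q1] none of whose conjugates is in [Q], but its norm is in [p]. *)
Lemma invariants_going_down :
  (forall p, exists Q, lies_over (val : {rmorphism A -> B}) Q p) ->
  going_down (val : {rmorphism A -> B}).
Proof.
move=> lying p Q pQ; have [Q1 Q1p] := lying p.
have [hQ1 Q11 Q1M] := specP Q1.
have preim (P : spec B) g : is_prime [set b | P (act g b)].
  have [hP P1 PM] := specP P; split=> [||a b] /=; first split=> [|a b|a b] /=.
  - by rewrite rmorph0; apply: ideal0.
  - by rewrite rmorphD; apply: idealD.
  - by rewrite rmorphM; apply: ideal_mull.
  - by rewrite rmorph1.
  - by rewrite rmorphM; apply: PM.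
have [[g sQ1]|none] :=
    pselect (exists g, spec_set Q1 `<=` [set b | Q (act g b)]).
  exists (Spec (preim Q1 g^-1%g)); split=> [a|b /= /sQ1 /=].
    by rewrite /= invariant_fix; apply: Q1p.
  by rewrite -ractM mulgV ract1.
have [||_ /mapP[g _ ->]|_ /mapP[g _ ->] sQ1|x Q1x xP] :=
    @prime_avoidance B [seq [set b | Q (act g b)] | g <- enum G] Q1.
- by split=> x y; [apply: idealD|move=> Q1x _; apply: ideal_mulr].
- by exists 0; apply: ideal0.
- exact: preim.
- by apply: none; exists g.
pose N : A := Invariants (norm_invariant x).
have /pQ : p N.
  apply/Q1p; rewrite /= (bigD1 1%g) //= ract1.
  exact: ideal_mulr.
rewrite /= -big_enum -(big_map (fun g => act g x) xpredT id) => QN.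
exfalso; apply: prime_prod QN; first exact: specP.
move=> _ /mapP[g _ ->]; apply: (xP [set b | Q (act g b)]).
by apply/mapP; exists g; rewrite ?mem_enum.
Qed.

Variable w : B.
Hypothesis wG : #|G|%:R * w = 1.

Lemma reynolds_invariant b : w * (\sum_(g : G) act g b) \in Defs.invariant act.
Proof.
apply/invariantP => h; rewrite rmorphM rmorph_sum.
rewrite act_reindex; congr (_ * _).
rewrite -[act h w]mul1r -wG mulrAC -{1}(rmorph_nat (act h)).
by rewrite -rmorphM wG rmorph1 mul1r.
Qed.

Definition reynolds b : A := Invariants (reynolds_invariant b).

Lemma reynoldsD x y : reynolds (x + y) = reynolds x + reynolds y.
Proof.
apply: val_inj => /=; rewrite -mulrDr -big_split; congr (_ * _).
by apply: eq_bigr => g _; rewrite rmorphD.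
Qed.

Lemma reynoldsM (a : A) x : reynolds (val a * x) = a * reynolds x.
Proof.
apply: val_inj => /=; rewrite [RHS]mulrCA; congr (_ * _); rewrite mulr_sumr.
by apply: eq_bigr => g _; rewrite rmorphM invariant_fix.
Qed.

Lemma reynolds1 : reynolds 1 = 1.
Proof.
apply: val_inj => /=; under eq_bigr do rewrite rmorph1.
by rewrite sumr_const mulrC.
Qed.

End Invariants.

Theorem corollary2p9 (n : nat) (n_ge1 : (1 <= n)%N)
    (G : finGroupType) (B : comPzRingType) (act : ring_action G B)
    (noethB : noetherian B) (unitG : is_unit (#|G|%:R : B)) :
  serre n B -> serre n (invariants act).
Proof.
have [w wG] := unitG; pose f : {rmorphism invariants act -> B} := val.
apply: (@retract_serre _ _ f (reynolds act wG)) => //.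
- exact: reynoldsD.
- exact: reynoldsM.
- exact: reynolds1.
apply: invariants_going_down => p; apply: (@retract_lying_over _ _ f _) => //.
- exact: (reynoldsD act wG).
- exact: reynoldsM.
- exact: reynolds1.
Qed.
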